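(* Let $X$ be a real Hilbert space and let $A\colon X\rightrightarrows X$ and $B\colon X\rightrightarrows X$ be maximally monotone and paramonotone, with $Z\neq\varnothing$. Then the following are equivalent: (i) $J_AP_{\operatorname{Fix} T_{\mathrm{DR}}}=P_Z$. (ii) $J_A|_{\operatorname{Fix} T_{\mathrm{DR}}}=P_Z|_{\operatorname{Fix} T_{\mathrm{DR}}}$. (iii) $K\perp (Z-Z)$.
   Context: A set-valued operator $C\colon X\rightrightarrows X$ is monotone if $\langle x-y,u-v\rangle\ge 0$ for all $(x,u),(y,v)\in\operatorname{gra}C$, and maximally monotone if no monotone operator has a graph properly containing $\operatorname{gra} C$. A monotone operator $C$ is paramonotone if whenever $(x,u),(y,v)\in\operatorname{gra}C$ and $\langle x-y,u-v\rangle=0$, then $(x,v)\in\operatorname{gra}C$ and $(y,u)\in\operatorname{gra}C$. $J_C=(\mathrm{Id}+C)^{-1}$ is the resolvent and $R_C=2J_C-\mathrm{Id}$. The Douglas–Rachford operator of $(A,B)$ is $T_{\mathrm{DR}}=\mathrm{Id}-J_A+J_BR_A$. The primal solution set is $Z=(A+B)^{-1}(0)=\{x : 0\in Ax+Bx\}$ and the (Attouch–Théra) dual solution set is $K=\big(A^{-1}+(-\mathrm{Id})\circ B^{-1}\circ(-\mathrm{Id})\big)^{-1}(0)$. $\operatorname{Fix}$ denotes the fixed point set; $P_C$ is the projector onto a nonempty closed convex set $C$ (under the hypotheses, $Z$ and $\operatorname{Fix} T_{\mathrm{DR}}$ are nonempty, closed and convex). $Z-Z=\{z_1-z_2 : z_1,z_2\in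 Z\}$, and $K\perp(Z-Z)$ means $\langle k,w\rangle=0$ for all $k\in K$, $w\in Z-Z$. *)

(* Defs.v *)
From HB Require Import structures.
From mathcomp Require Import all_boot all_order all_algebra.
From mathcomp Require Import boolp classical_sets reals topology normedtype.

Set Implicit Arguments.
Unset Strict Implicit.
Unset Printing Implicit Defensive.

Import Order.TTheory GRing.Theory Num.Theory.
Import numFieldNormedType.Exports.

Local Open Scope classical_set_scope.
Local Open Scope ring_scope.

(* A real Hilbert space is a complete normed module [X] over [R : realType]
   together with an inner product [dot : {dot X for idfun}] (bilinear,
   symmetric, positive definite) that induces the norm of [X]. *)
Definition induces_norm (R : realType) (X : completeNormedModType R)
    (dot : {dot X for idfun}) : Prop :=
  forall x : X, `|x| ^+ 2 = dot x x.

Section Operators.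
Variable (R : realType) (X : completeNormedModType R).

Definition operator : Type := X -> set X.

Implicit Types (A B C : operator) (f : X -> X) (S : set X).

Definition gra C : set (X * X) := [set xu | C xu.1 xu.2].

(* A map X -> X regarded as an operator. *)
Definition single f : operator := fun x => [set f x].

Definition op_add A B : operator := fun x => [set u + v | u in A x & v in B x].

Definition op_scale (a : R) C : operator := fun x => [set a *: u | u in C x].

Definition op_sub A B : operator := op_add A (op_scale (-1) B).

Definition op_comp A B : operator := fun x => \bigcup_(y in B x) A y.

Definition op_inv C : operator := fun u => [set x | C x u].

Definition op_fix C : set X := [set x | C x x].

(* Resolvents are kept set-valued, as the definition (Id + C)^-1 reads; when C
   is maximally monotone they have exactly one value at every point, so that
   the operators below are the usual single-valued ones. *)
Definition resolvent C : operator := op_inv (op_add (single id) C).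

Definition reflected_resolvent C : operator :=
  op_sub (op_scale 2 (resolvent C)) (single id).

Definition douglas_rachford A B : operator :=
  op_add (op_sub (single id) (resolvent A))
         (op_comp (resolvent B) (reflected_resolvent A)).

Definition primal_solutions A B : set X := op_inv (op_add A B) 0.

Definition dual_solutions A B : set X :=
  op_inv (op_add (op_inv A)
                 (op_comp (single -%R) (op_comp (op_inv B) (single -%R)))) 0.

(* The nearest point of S to x, which exists and is unique when S is nonempty,
   closed and convex; the default value x is irrelevant in that case. *)
Definition projector S : X -> X := fun x =>
  xget x [set p | S p /\ forall s, S s -> `|x - p| <= `|x - s|].

Definition set_sub (S1 S2 : set X) : set X := [set a - b | a in S1 & b in S2].

Section InnerProduct.
Variable dot : {dot X for idfun}.

Definition monotone C : Prop :=
  forall x u y v, C x u -> C y v -> 0 <= dot (x - y) (u - v).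

Definition maximally_monotone C : Prop :=
  monotone C /\ forall D, monotone D -> ~ (gra C `<` gra D).

Definition paramonotone C : Prop :=
  monotone C /\
  forall x u y v, C x u -> C y v -> dot (x - y) (u - v) = 0 -> C x v /\ C y u.

Definition orthogonal_sets (S1 S2 : set X) : Prop :=
  forall s t, S1 s -> S2 t -> dot s t = 0.

End InnerProduct.
End Operators.

(* Main.v *)
(* Paramonotonicity makes the set of pairs (z, k) with k in A z and -k in B z
   the full rectangle Z x K, so Fix T_DR = Z + K and J_A (z + k) = z; moreover
   Z and K are closed and convex, as intersections of values of maximally
   monotone operators.  If J_A = P_Z on Fix T_DR, then P_Z (z + k) = z, so the
   obtuse angle criterion gives <k, z' - z> <= 0 for all z, z' in Z, and equality
   follows by exchanging z and z'.  Conversely, if K is orthogonal to Z - Z, the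
   distance to Z + K separates, so P_(Z+K) x = P_Z x + P_K (x - z0), which J_A
   maps to P_Z x. *)
Require Import Defs.
From mathcomp Require Import all_boot all_order all_algebra.
From mathcomp Require Import boolp classical_sets reals topology normedtype.
From mathcomp Require Import lra.

Set Implicit Arguments.
Unset Strict Implicit.
Unset Printing Implicit Defensive.

Import Order.TTheory GRing.Theory Num.Theory.
Import numFieldNormedType.Exports.

Local Open Scope classical_set_scope.
Local Open Scope ring_scope.

(** * Inner product calculus and nearest points in closed convex sets *)

Section Projection.
Variables (R : realType) (X : completeNormedModType R).
Implicit Types (S : set X) (x y p q : X).

Definition segment_convex S : Prop :=
  forall x y (t : R), 0 <= t <= 1 -> S x -> S y -> S (x + t *: (y - x)).

Definition nearest S x p : Prop := S p /\ forall s, S s -> `|x - p| <= `|x - s|.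

Lemma segment_convexI S1 S2 :
  segment_convex S1 -> segment_convex S2 -> segment_convex (S1 `&` S2).
Proof.
by move=> c1 c2 x y t t01 [x1 x2] [y1 y2]; split; [exact: c1|exact: c2].
Qed.

Lemma segment_convex_opp S :
  segment_convex S -> segment_convex [set x | S (- x)].
Proof.
move=> cS x y t t01 Sx Sy /=.
by rewrite opprD -scalerN opprD; exact: cS.
Qed.

Lemma segment_convexD S1 S2 : segment_convex S1 -> segment_convex S2 ->
  segment_convex [set a + b | a in S1 & b in S2].
Proof.
move=> c1 c2 _ _ t t01 [a1 a1S [b1 b1S <-]] [a2 a2S [b2 b2S <-]].
exists (a1 + t *: (a2 - a1)); first exact: c1.
exists (b1 + t *: (b2 - b1)); first exact: c2.
by rewrite addrACA -scalerDr opprD [in RHS]addrACA.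
Qed.

Variable dot : {dot X for idfun}.
Hypothesis dot_norm : induces_norm dot.

Lemma dotC x y : dot x y = dot y x.
Proof. by rewrite hermitian_subproof expr0 mul1r. Qed.

Lemma dotDl x y w : dot (x + y) w = dot x w + dot y w.
Proof. exact: linearDl. Qed.

Lemma dotNl x w : dot (- x) w = - dot x w.
Proof. exact: linearNl. Qed.

Lemma dotZl a x w : dot (a *: x) w = a * dot x w.
Proof. exact: linearZl_LR. Qed.

Lemma dotDr w x y : dot w (x + y) = dot w x + dot w y.
Proof. exact: linearDr. Qed.

Lemma dotNr w x : dot w (- x) = - dot w x.
Proof. exact: linearNr. Qed.

Lemma dotZr w a x : dot w (a *: x) = a * dot w x.
Proof. by rewrite dotC dotZl dotC. Qed.

Let dotE := (dotDl, dotDr, dotNl, dotNr, dotZl, dotZr).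

Lemma dot_ge0 x : 0 <= dot x x.
Proof. by rewrite -dot_norm sqr_ge0. Qed.

Lemma dot_eq0 x : dot x x = 0 -> x = 0.
Proof. by rewrite -dot_norm => /eqP; rewrite sqrf_eq0 normr_eq0 => /eqP. Qed.

Lemma le_norm_dot x y : (`|x| <= `|y|) = (dot x x <= dot y y).
Proof. by rewrite -!dot_norm ler_sqr// nnegrE. Qed.

Lemma nearest_dot S x p : nearest S x p <->
  S p /\ forall s, S s -> dot (x - p) (x - p) <= dot (x - s) (x - s).
Proof.
by split=> -[Sp H]; split=> // s /H; rewrite le_norm_dot.
Qed.

(* The parallelogram identity, arranged around the midpoint of [p] and [q]. *)
Lemma dot_midpoint x p q : dot (p - q) (p - q) =
  2 * dot (x - p) (x - p) + 2 * dot (x - q) (x - q)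
  - 4 * dot (x - (p + 2^-1 *: (q - p))) (x - (p + 2^-1 *: (q - p))).
Proof. rewrite !dotE (dotC p x) (dotC q x) (dotC q p); lra. Qed.

Lemma half_itv : 0 <= (2^-1 : R) <= 1.
Proof. lra. Qed.

(** The midpoint of [p] and [q] lies in [S], so it is no closer to [x] than either of them;
    [dot_midpoint] then leaves no room for [p - q] to be nonzero. *)
Lemma nearest_unique S x p q :
  segment_convex S -> nearest S x p -> nearest S x q -> p = q.
Proof.
move=> cS /nearest_dot[Sp p_min] /nearest_dot[Sq q_min].
apply/eqP; rewrite -subr_eq0; apply/eqP/dot_eq0/eqP.
rewrite eq_le dot_ge0 andbT (dot_midpoint x).
have Sm := cS _ _ _ half_itv Sp Sq.
have := p_min _ Sm; have := q_min _ Sm; lra.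
Qed.

(** The sets [B e] of points of [S] that are minimal up to [e] generate a proper filter. The
    midpoint identity makes it Cauchy, so completeness supplies a limit. *)
Lemma nearest_exists S x :
  closed S -> segment_convex S -> S !=set0 -> exists p, nearest S x p.
Proof.
move=> clS cS [s0 Ss0].
pose D := [set dot (x - s) (x - s) | s in S].
have lbD : lbound D 0 by move=> _ [s _ <-]; exact: dot_ge0.
have infD : has_inf D.
  by split; [exists (dot (x - s0) (x - s0)), s0 | exists 0].
pose d := inf D.
have d_le s : S s -> d <= dot (x - s) (x - s).
  by move=> Ss; apply: ge_inf; [exists 0 | exists s].
pose B (e : R) := [set s | S s /\ dot (x - s) (x - s) < d + e].
pose F := filter_from [set e : R | 0 < e] B.
have FF : ProperFilter F.
  apply: filter_from_proper.
    apply: filter_from_filter; first by exists 1 => /=.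
    move=> e1 e2 /= e10 e20; exists (Num.min e1 e2).
      by rewrite /= lt_min e10.
    by move=> s [Ss lt_s]; split; split=> //; apply: lt_le_trans lt_s _;
      rewrite lerD2l ge_min lexx ?orbT.
  by move=> e /= /inf_adherent-/(_ _ infD)[_ [s Ss <-] lt_s]; exists s.
have /cauchy_cvgP /cvg_ex[p Fp] : cauchy F.
  (* For [s], [t] in [B e] the midpoint is at squared distance at least [d], so [dot_midpoint]
     bounds the squared distance of [s] and [t] strictly by 4(d + e) - 4d = [eps ^+ 2]. *)
  apply: cauchy_exP => eps eps0; pose e := eps ^+ 2 / 4.
  have e0 : 0 < e by rewrite divr_gt0// exprn_gt0.
  have [_ [s Ss <-] lt_s] := inf_adherent e0 infD.
  exists s, e => // t [St lt_t] /=; rewrite -ball_normE /ball_ /=.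
  rewrite -ltr_sqr ?nnegrE// ?ltW// dot_norm (dot_midpoint x).
  have := d_le _ (cS _ _ _ half_itv Ss St).
  by rewrite /e in lt_s lt_t; rewrite -/d in lt_s; lra.
exists p; apply/nearest_dot; split.
  by apply: (@closed_cvg _ _ F _ id _ clS _ _ Fp); exists 1 => //= s [].
suff le_d : dot (x - p) (x - p) <= d by move=> s /d_le; exact: le_trans.
apply/ler_addgt0Pr => e e0.
have cv : `|x - s| ^+ 2 @[s --> F] --> `|x - p| ^+ 2.
  by apply: cvgM; apply: cvg_norm; apply: cvgB => //; exact: cvg_cst.
rewrite -dot_norm; apply: (@closed_cvg _ _ F _ _ _ (@closed_le R (d + e)) _ _ cv).
by exists e => // s [_ /ltW]; rewrite -dot_norm.
Qed.

Lemma projector_nearest S x p :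
  segment_convex S -> nearest S x p -> projector S x = p.
Proof.
by move=> cS p_near; apply: xget_unique => // q /nearest_unique; exact.
Qed.

Lemma projector_id S x : segment_convex S -> S x -> projector S x = x.
Proof.
move=> cS Sx; apply: projector_nearest => //; split=> // s _.
by rewrite subrr normr0.
Qed.

(** Were the inner product positive, a short move from [p] towards [s] would stay in [S] and come
    closer to [x]. *)
Lemma nearest_angle S x p s :
  segment_convex S -> nearest S x p -> S s -> dot (x - p) (s - p) <= 0.
Proof.
move=> cS /nearest_dot[Sp p_min] Ss.
set a := dot (x - p) (s - p); rewrite leNgt; apply/negP => a0.
(* Moving by [t] changes the squared distance by t(tb - 2a), which is negative as soon as tb <= a.
   The [+ 1] keeps the denominator positive, and the minimum with 1 keeps the point on the
   segment. *)
pose b := dot (s - p) (s - p); pose t := Num.min 1 (a / (b + 1)).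
have b0 : 0 <= b := dot_ge0 _.
have t0 : 0 < t by rewrite lt_min ltr01 divr_gt0// ltr_wpDl.
have tb : t * (b + 1) <= a by rewrite -ler_pdivlMr ?ltr_wpDl// ge_min lexx orbT.
have t1 : 0 <= t <= 1 by rewrite ltW// ge_min lexx.
have := p_min _ (cS _ _ _ t1 Sp Ss).
have -> : x - (p + t *: (s - p)) = (x - p) - t *: (s - p).
  by rewrite opprD addrA.
rewrite (dotDl (x - p)) !(dotDr _ (x - p)) !(dotNl, dotNr, dotZl, dotZr).
rewrite (dotC (s - p) (x - p)) -/a -/b; nra.
Qed.

Lemma closed_halfspace y w : closed [set x | 0 <= dot (x - y) w].
Proof.
(* By polarization [f x] is 4 times [dot (x - y) w], so continuity of the norm is enough. *)
pose f x := `|x - y + w| ^+ 2 - `|x - y - w| ^+ 2.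
have -> : [set x | 0 <= dot (x - y) w] = f @^-1` [set r | 0 <= r].
  apply/seteqP; split=> x /=; rewrite /f !dot_norm !(dotDl (x - y)) !(dotDr _ (x - y));
    rewrite !(dotNl w) !(dotNr _ w) (dotC w (x - y)); lra.
suff fc : continuous f by apply: (preimage_closed _ (@closed_ge R 0)) => x _.
have nc v : continuous (fun x : X => `|x - y + v|).
  move=> x; apply: cvg_norm; apply: cvgD; last exact: cvg_cst.
  by apply: cvgB => //; exact: cvg_cst.
by move=> x; apply: cvgB; apply: cvgM; exact: nc.
Qed.

Lemma segment_convex_halfspace y w : segment_convex [set x | 0 <= dot (x - y) w].
Proof. move=> x z t /andP[t0 t1] /=; rewrite !dotE; nra. Qed.

End Projection.

(** * Monotone operators, resolvents and Douglas-Rachford fixed points *)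

Section MonotoneOperators.
Variables (R : realType) (X : completeNormedModType R).
Variable dot : {dot X for idfun}.
Hypothesis dot_norm : induces_norm dot.
Implicit Types (A B C : operator X) (x y u v : X).

(** Otherwise adjoining [(x, u)] to the graph would give a proper monotone extension [D]. *)
Lemma maximally_monotoneP C x u : maximally_monotone dot C ->
  (forall y v, C y v -> 0 <= dot (x - y) (u - v)) -> C x u.
Proof.
move=> [mC maxC] xu; apply: contrapT => nCxu.
pose D : operator X := fun y => C y `|` [set v | y = x /\ v = u].
apply: (maxC D).
  move=> y1 v1 y2 v2 [C1|[-> ->]] [C2|[-> ->]]; [exact: mC| |exact: xu|].
    by rewrite -opprB -(opprB u) (dotNl dot) (dotNr dot) opprK; exact: xu.
  by rewrite !subrr -(subrr x) dot_ge0.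
by split=> [[y v] Cyv|/(_ (x, u)) nsub]; [left|apply: nCxu; apply: nsub; right].
Qed.

Lemma monotone_inv C : monotone dot C -> monotone dot (op_inv C).
Proof. by move=> mC u x v y Cxu Cyv; rewrite dotC; exact: mC. Qed.

Lemma maximally_monotone_inv C :
  maximally_monotone dot C -> maximally_monotone dot (op_inv C).
Proof.
move=> [mC maxC]; split; first exact: monotone_inv.
move=> D mD [CD nDC]; apply: (maxC (op_inv D)); first exact: monotone_inv.
split=> [[x u] /= Cxu|sub]; first exact: (CD (u, x)).
by apply: nDC => -[u x] /= Dux; exact: (sub (x, u)).
Qed.

(** Writes a value as an intersection of half-spaces, from which closedness and convexity are read
    off. *)
Lemma maximally_monotone_inv_bigcap C u : maximally_monotone dot C ->
  op_inv C u = \bigcap_(yv in gra C) [set x | 0 <= dot (x - yv.1) (u - yv.2)].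
Proof.
move=> mC; apply/seteqP; split=> x.
  by move=> Cxu [y v] Cyv; exact: mC.1.
by move=> xu; apply: maximally_monotoneP mC _ => y v Cyv; exact: (xu (y, v)).
Qed.

Lemma closed_inv_value C u : maximally_monotone dot C -> closed (op_inv C u).
Proof.
move=> mC; rewrite maximally_monotone_inv_bigcap//.
by apply: closed_bigI => yv _; exact: closed_halfspace.
Qed.

Lemma segment_convex_inv_value C u :
  maximally_monotone dot C -> segment_convex (op_inv C u).
Proof.
move=> mC; rewrite maximally_monotone_inv_bigcap// => x y t t01 xC yC yv Cyv.
by apply: segment_convex_halfspace => //; [exact: xC|exact: yC].
Qed.

Lemma closed_value C x : maximally_monotone dot C -> closed (C x).
(* [C x] is convertible to [op_inv (op_inv C) x]. *)
Proof. by move/maximally_monotone_inv/closed_inv_value; exact. Qed.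

Lemma segment_convex_value C x : maximally_monotone dot C -> segment_convex (C x).
Proof. by move/maximally_monotone_inv/segment_convex_inv_value; exact. Qed.

Lemma resolventE C x p : resolvent C x p <-> C p (x - p).
Proof.
split=> [[_ /= -> [v Cv <-]]|Cp]; first by rewrite addrC addKr.
by exists p => //; exists (x - p) => //; rewrite addrC subrK.
Qed.

Lemma resolvent_unique C x p q :
  monotone dot C -> resolvent C x p -> resolvent C x q -> p = q.
Proof.
move=> mC /resolventE Cp /resolventE Cq; apply/eqP; rewrite -subr_eq0.
apply/eqP/(dot_eq0 dot_norm)/eqP; rewrite eq_le (dot_ge0 dot_norm) andbT.
have := mC _ _ _ _ Cp Cq.
have -> : x - p - (x - q) = - (p - q) by rewrite opprB addrC subrKA opprB.
by rewrite dotNr oppr_ge0.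
Qed.

Lemma resolvent_set1 C x p :
  monotone dot C -> resolvent C x p -> resolvent C x = [set p].
Proof.
move=> mC Cp; apply/seteqP; split=> [q Cq|q /= -> //].
exact: resolvent_unique Cq Cp.
Qed.

(** With [dual_solutionsE], this presents the primal and dual solutions as the two projections of
    one set of pairs. *)
Lemma primal_solutionsE A B x :
  primal_solutions A B x <-> exists k, A x k /\ B x (- k).
Proof.
split=> [[u Au [v Bv uv]]|[k [Ak Bk]]].
  exists u; split=> //; rewrite (_ : - u = v)//.
  by apply/eqP; rewrite eq_sym -addr_eq0 addrC uv.
by exists k => //; exists (- k); rewrite ?subrr.
Qed.

Lemma dual_solutionsE A B k :
  dual_solutions A B k <-> exists x, A x k /\ B x (- k).
Proof.
split=> [[x Ax [_ [y [_ /= -> By] /= ->] xy]]|[x [Ak Bk]]].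
  by exists x; split=> //; have /eqP := xy; rewrite subr_eq0 => /eqP ->.
exists x => //; exists (- x); rewrite ?subrr//.
by exists x => //; exists (- k).
Qed.

(** With z = J_A x and k = x - z, the reflection R_A x is z - k, and x is fixed exactly when J_B (z
    - k) = z, that is, when -k lies in B z. *)
Lemma fix_douglas_rachfordE A B x : monotone dot A ->
  op_fix (douglas_rachford A B) x <->
  exists z k, [/\ A z k, B z (- k) & x = z + k].
Proof.
move=> mA; split.
  move=> [_ [_ -> [_ [a Ja <-] <-]] [b [_ [_ [a' Ja' <-] [_ [_ -> <-] <-]] Jb]]].
  rewrite !scaleN1r in Jb * => xE.
  have ba : b = a.
    by apply: (addrI (x - a)); rewrite xE subrK.
  (* The resolvent of [A] occurs twice in the operator, each time with its own value at [x];
     monotonicity identifies the two. *)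
  have aa : a' = a by exact: resolvent_unique mA Ja' Ja.
  move: Jb => /resolventE; rewrite ba aa => Bb; move/resolventE : Ja => Aa.
  exists a, (x - a); split=> //; last by rewrite addrC subrK.
  by move: Bb; rewrite scaler_nat mulr2n addrAC addrK opprB.
move=> [z [k [Azk Bzk ->]]].
have Jz : resolvent A (z + k) z by apply/resolventE; rewrite addrC addKr.
exists k.
  exists (z + k) => //; exists (- z); last by rewrite addrC addKr.
  by exists z => //; rewrite scaleN1r.
exists z; last by rewrite addrC.
exists (z - k); last first.
  by apply/resolventE; rewrite addrAC subrr add0r.
exists (2 *: z); first by exists z.
exists (- (z + k)); first by exists (z + k) => //; rewrite scaleN1r.
by rewrite scaler_nat mulr2n opprD addrA addrK.
Qed.

(* Monotonicity of [A] and [B] forces [dot (z - z') (k - k')] to be both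
   nonnegative and nonpositive; paramonotonicity then exchanges [k] and [k']. *)
Lemma solutions_exchange A B z k z' k' :
  paramonotone dot A -> paramonotone dot B ->
  A z k -> B z (- k) -> A z' k' -> B z' (- k') -> A z k' /\ B z (- k').
Proof.
move=> [mA pA] [mB pB] Ak Bk Ak' Bk'.
have dB : dot (z - z') (- k - - k') = - dot (z - z') (k - k').
  by rewrite -dotNr opprD.
have d0 : dot (z - z') (k - k') = 0.
  apply/eqP; rewrite eq_le (mA _ _ _ _ Ak Ak') andbT -oppr_ge0 -dB.
  exact: mB.
split; first by have [] := pA _ _ _ _ Ak Ak' d0.
by have [] := pB _ _ _ _ Bk Bk'; rewrite // dB d0 oppr0.
Qed.

End MonotoneOperators.

(** * Primal and dual solution sets under paramonotonicity, and the equivalence *)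

Section DouglasRachford.
Variables (R : realType) (X : completeNormedModType R).
Variable dot : {dot X for idfun}.
Hypothesis dot_norm : induces_norm dot.
Variables A B : operator X.
Hypotheses (maxA : maximally_monotone dot A) (paraA : paramonotone dot A).
Hypotheses (maxB : maximally_monotone dot B) (paraB : paramonotone dot B).

Let Z := primal_solutions A B.
Let K := dual_solutions A B.
Let F := op_fix (douglas_rachford A B).

(** Each of [z] and [k] comes with a partner of its own; exchanging partners pairs them with each
    other. *)
Lemma primal_dual_solutions z k : Z z -> K k -> A z k /\ B z (- k).
Proof.
move=> /primal_solutionsE[k' [Ak' Bk']] /dual_solutionsE[z' [Az' Bz']].
exact: (solutions_exchange paraA paraB Ak' Bk' Az' Bz').
Qed.

Lemma fix_douglas_rachford_sum : F = [set z + k | z in Z & k in K].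
Proof.
apply/seteqP; split=> x.
  move=> /(fix_douglas_rachfordE dot_norm B _ maxA.1)[z [k [Az Bz ->]]].
  exists z; first by apply/primal_solutionsE; exists k.
  by exists k => //; apply/dual_solutionsE; exists z.
move=> [z Zz [k Kk <-]]; have [Az Bz] := primal_dual_solutions Zz Kk.
by apply/(fix_douglas_rachfordE dot_norm B _ maxA.1); exists z, k.
Qed.

Lemma resolvent_solutions z k : Z z -> K k -> resolvent A (z + k) = [set z].
Proof.
move=> Zz Kk; apply: (resolvent_set1 dot_norm maxA.1); apply/resolventE.
by rewrite addrC addKr; have [] := primal_dual_solutions Zz Kk.
Qed.

(** A single dual solution serves all primal ones, so [Z] is an intersection of two inverse values,
    hence closed and convex. *)
Lemma primal_solutions_inv_values k :
  K k -> Z = op_inv A k `&` op_inv B (- k).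
Proof.
move=> Kk; apply/seteqP; split=> z; first by move=> /primal_dual_solutions; exact.
by move=> [Az Bz]; apply/primal_solutionsE; exists k.
Qed.

Lemma dual_solutions_values z : Z z -> K = A z `&` [set k | B z (- k)].
Proof.
move=> Zz; apply/seteqP; split=> k; first exact: primal_dual_solutions.
by move=> [Az Bz]; apply/dual_solutionsE; exists z.
Qed.

Hypothesis Z_neq0 : Z !=set0.

Lemma dual_solutions_neq0 : K !=set0.
Proof.
have [z /primal_solutionsE[k [Ak Bk]]] := Z_neq0.
by exists k; apply/dual_solutionsE; exists z.
Qed.

Lemma segment_convex_primal : segment_convex Z.
Proof.
have [k Kk] := dual_solutions_neq0; rewrite (primal_solutions_inv_values Kk).
by apply: segment_convexI; exact: segment_convex_inv_value.
Qed.

Lemma closed_primal : closed Z.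
Proof.
have [k Kk] := dual_solutions_neq0; rewrite (primal_solutions_inv_values Kk).
by apply: closedI; exact: closed_inv_value.
Qed.

Lemma segment_convex_dual : segment_convex K.
Proof.
have [z Zz] := Z_neq0; rewrite (dual_solutions_values Zz).
apply: segment_convexI; first exact: segment_convex_value.
by apply: segment_convex_opp; exact: segment_convex_value.
Qed.

Lemma closed_dual : closed K.
Proof.
have [z Zz] := Z_neq0; rewrite (dual_solutions_values Zz).
apply: closedI; first exact: closed_value.
have cBz : closed (B z) by exact: closed_value.
by apply: (preimage_closed _ cBz) => k _; exact: opp_continuous.
Qed.

Lemma segment_convex_fix : segment_convex F.
Proof.
rewrite fix_douglas_rachford_sum; apply: segment_convexD.
  exact: segment_convex_primal.
exact: segment_convex_dual.
Qed.

Lemma resolvent_projector_fix x :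
  op_comp (resolvent A) (single (projector F)) x =
  resolvent A (projector F x).
Proof. by rewrite /op_comp /single bigcup_set1. Qed.

Lemma dual_orthogonal :
  (forall x, F x -> resolvent A x = single (projector Z) x) ->
  orthogonal_sets dot K (set_sub Z Z).
Proof.
move=> JP.
have P_Z z k : Z z -> K k -> projector Z (z + k) = z.
  move=> Zz Kk; have Fzk : F (z + k).
    by rewrite fix_douglas_rachford_sum; exists z => //; exists k.
  by have := JP _ Fzk; rewrite (resolvent_solutions Zz Kk) => /seteqP[/(_ z erefl)].
have kz_le0 k z z' : K k -> Z z -> Z z' -> dot k (z' - z) <= 0.
  move=> Kk Zz Zz'.
  (* The angle criterion needs a true nearest point, which the value of [projector] is only once
     existence is known. *)
  have [p p_near] := nearest_exists dot_norm (z + k) closed_primal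
    segment_convex_primal Z_neq0.
  have pz : p = z.
    by rewrite -(projector_nearest dot_norm segment_convex_primal p_near) P_Z.
  have := nearest_angle dot_norm segment_convex_primal p_near Zz'.
  by rewrite pz addrC addKr.
move=> k _ Kk [z Zz [z' Zz' <-]]; apply/eqP; rewrite eq_le kz_le0//=.
by rewrite -oppr_le0 -dotNr opprB kz_le0.
Qed.

(* Since [K] is orthogonal to [Z - Z], minimizing [|x - (z + k)|] over [Z + K]
   separates into minimizing [|x - z|] over [Z] and [|x - z0 - k|] over [K]. *)
Lemma nearest_fix x z0 p q : orthogonal_sets dot K (set_sub Z Z) ->
  Z z0 -> nearest Z x p -> nearest K (x - z0) q -> nearest F x (p + q).
Proof.
move=> KZ Zz0 /(nearest_dot dot_norm)[Zp p_min] /(nearest_dot dot_norm)[Kq q_min].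
have split_dot z k : Z z -> K k -> dot (x - (z + k)) (x - (z + k)) =
    dot (x - z) (x - z) + dot (x - z0 - k) (x - z0 - k)
    - dot (x - z0) (x - z0).
  move=> Zz Kk; have : dot k (z - z0) = 0.
    by apply: KZ => //; exists z => //; exists z0.
  rewrite !(dotDl, dotDr, dotNl, dotNr) (dotC dot x k) (dotC dot z k) (dotC dot z0 k).
  rewrite (dotC dot z x) (dotC dot z0 x); lra.
apply/(nearest_dot dot_norm); rewrite fix_douglas_rachford_sum; split.
  by exists p => //; exists q.
move=> _ [z Zz [k Kk <-]]; rewrite !split_dot// lerD2r.
by apply: lerD; [exact: p_min|exact: q_min].
Qed.

Lemma resolvent_projectors : orthogonal_sets dot K (set_sub Z Z) ->
  op_comp (resolvent A) (single (projector F)) = single (projector Z).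
Proof.
move=> KZ; apply/funext => x; rewrite resolvent_projector_fix.
have [z0 Zz0] := Z_neq0.
have [p p_near] := nearest_exists dot_norm x closed_primal
  segment_convex_primal Z_neq0.
have [q q_near] := nearest_exists dot_norm (x - z0) closed_dual
  segment_convex_dual dual_solutions_neq0.
(* The projection onto [F] splits into a primal part [p] and a dual part [q], and the resolvent of
   [A] returns the primal part. *)
have pq_near := nearest_fix KZ Zz0 p_near q_near.
rewrite (projector_nearest dot_norm segment_convex_fix pq_near).
rewrite (resolvent_solutions p_near.1 q_near.1) /single.
by rewrite (projector_nearest dot_norm segment_convex_primal p_near).
Qed.

End DouglasRachford.

Theorem theorem4p5 (R : realType) (X : completeNormedModType R)
    (dot : {dot X for idfun}) (A B : operator X) :
  induces_norm dot ->
  maximally_monotone dot A -> paramonotone dot A ->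
  maximally_monotone dot B -> paramonotone dot B ->
  primal_solutions A B !=set0 ->
  let Z := primal_solutions A B in
  let K := dual_solutions A B in
  let F := op_fix (douglas_rachford A B) in
  [<-> op_comp (resolvent A) (single (projector F)) = single (projector Z);
       forall x, F x -> resolvent A x = single (projector Z) x;
       orthogonal_sets dot K (set_sub Z Z)].
Proof.
move=> dot_norm maxA paraA maxB paraB Z_neq0 Z K F.
split=> [JP x Fx|]; last split.
(* The projector onto [F] fixes [x], so the global identity restricts to [F]. *)
- rewrite -JP resolvent_projector_fix (projector_id dot_norm _ Fx)//.
  exact: (segment_convex_fix dot_norm maxA paraA maxB paraB Z_neq0).
- exact: (dual_orthogonal dot_norm maxA paraA maxB paraB Z_neq0).
- exact: (resolvent_projectors dot_norm maxA paraA maxB paraB Z_neq0).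
Qed.
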